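(* Let $n\ge 1$, let $\pi\in S_{n+1}$, and let $f$ be the density function of a Laplace distribution with mean zero, i.e. $f(x)=\frac{1}{2b}e^{-|x|/b}$ for some $b>0$. Then \[ \mathbb{P}(f,\pi)=\frac{1}{2^n\prod_{j=1}^n \mathrm{lev}(\pi)_j}. \]
   Context: Random walk setup: for a probability density $f:\mathbb{R}\to\mathbb{R}$ of a continuous distribution, let $X_1,\dots,X_n$ be independent random variables with density $f$ (the steps), and let the positions be $Z_1=0$ and $Z_i=X_1+\cdots+X_{i-1}$ for $2\le i\le n+1$. The ordinal pattern of a tuple $(z_1,\dots,z_{n+1})$ of distinct reals is the permutation $\pi\in S_{n+1}$ with $\pi(i)=|\{j\in\{1,\dots,n+1\}: z_i\ge z_j\}|$. $\mathbb{P}(f,\pi)$ denotes the probability that $(Z_1,\dots,Z_{n+1})$ has ordinal pattern $\pi$. For $\pi\in S_{n+1}$ and $j\in[n]=\{1,\dots,n\}$, $\mathrm{lev}(\pi)_j$ is the number of $i\in[n]$ such that $\pi(i)\le j<\pi(i+1)$ or $\pi(i+1)\le j<\pi(i)$. *)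

(* Defs.v *)
From mathcomp Require Import all_boot all_order all_algebra all_fingroup.
From mathcomp Require Import all_classical all_reals all_analysis.

Set Implicit Arguments.
Unset Strict Implicit.
Unset Printing Implicit Defensive.

Import Order.TTheory GRing.Theory Num.Theory.

Local Open Scope classical_set_scope.
Local Open Scope ring_scope.

(* Indices and values are 0-based throughout: 'I_n.+1 stands for
   {1, ..., n+1} and 'I_n for {1, ..., n}. *)

Section RandomVariables.
Context d (T : measurableType d) (R : realType) (P : probability T R).

Definition has_density (X : {RV P >-> R}) (f : R -> R) : Prop :=
  forall A : set R, measurable A ->
    distribution P X A = (\int[lebesgue_measure]_(x in A) (f x)%:E)%E.

Definition mutually_independent (I : finType) (X : I -> {RV P >-> R}) : Prop :=
  forall (J : {set I}) (B : I -> set R), (forall i, measurable (B i)) ->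
    P (\bigcap_(i in [set` J]) (X i @^-1` B i)) =
    (\prod_(i in J) P (X i @^-1` B i))%E.

End RandomVariables.

Definition laplace_pdf (R : realType) (b : R) (x : R) : R :=
  1 / (2 * b) * expR (- `|x| / b).

(* Position i (0-based) is the sum of the steps strictly before i; position 0
   is 0. *)
Definition walk_position (R : realType) (n : nat) (x : 'I_n -> R)
    (i : 'I_n.+1) : R :=
  \sum_(k < n | (k < i)%N) x k.

(* The successor in (pi i).+1 turns the 0-based value into the 1-based rank. *)
Definition has_ordinal_pattern (R : realType) (m : nat) (z : 'I_m -> R)
    (pi : 'S_m) : Prop :=
  injective z /\
  forall i : 'I_m, (pi i).+1 = #|[pred j : 'I_m | z j <= z i]|.

(* For i : 'I_n, the elements inord i and inord i.+1 of 'I_n.+1 are i and i+1.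
   The 1-based condition pi(i) <= j < pi(i+1) is invariant under shifting both
   the level and the values by one. *)
Definition lev (n : nat) (pi : 'S_n.+1) (j : 'I_n) : nat :=
  #|[pred i : 'I_n | (pi (inord i) <= j < pi (inord i.+1))%N
                 || (pi (inord i.+1) <= j < pi (inord i))%N]|.

(* Main.v *)
(* The density of the walk at positions z with z_1 = 0 is
   prod_k f(z_(k+1) - z_k).  On the event that the pattern is pi, let g_j > 0 be
   the gap between the j-th and the (j+1)-st smallest position: each |z_(k+1) -
   z_k| is the sum of the gaps that the k-th step crosses, so that
   sum_k |z_(k+1) - z_k| = sum_j lev(pi)_j g_j and the density factors over the
   gaps as prod_j (2b)^-1 exp(- lev(pi)_j g_j / b).  By Tonelli the positions may
   be integrated in any order; integrating out an extreme position removes one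
   extreme gap and contributes the factor 1 / (2 lev(pi)_j), until only the
   starting position is left. *)
Require Import Defs.
From HB Require Import structures.
From mathcomp Require Import all_boot all_order all_algebra all_fingroup.
From mathcomp Require Import all_classical all_reals all_analysis.
From mathcomp Require Import measurable_realfun ring.

Set Implicit Arguments.
Unset Strict Implicit.
Unset Printing Implicit Defensive.

Import Order.TTheory GRing.Theory Num.Theory.

Local Open Scope classical_set_scope.
Local Open Scope ring_scope.

(** * Integrals over the real line *)

Section lebesgue_real_line.
Local Open Scope ereal_scope.
Context {R : realType}.
Local Notation mu := (@lebesgue_measure R).

(** A shift preserves the length of half-open intervals, and this determines Lebesgue measure. *)
Lemma lebesgue_measure_translation (a : R) (A : set R) : measurable A ->
  pushforward mu ((fun x => x + a)%R : _ -> measurableTypeR R) A = mu A.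
Proof.
have ma : measurable_fun setT
    ((fun x => x + a)%R : measurableTypeR R -> measurableTypeR R).
  by exact: measurable_funD.
move=> mA; apply/esym/lebesgue_measure_unique => //=.
move=> _ [[x y]] _ <-.
rewrite /pushforward.
have -> : (fun t => t + a)%R @^-1` `]x, y]%classic = `](x - a)%R, (y - a)%R]%classic.
  by apply/seteqP; split=> t /=; rewrite !in_itv/= ltrBlDr lerBrDr.
rewrite !lebesgue_measure_itv/= !lte_fin ltrD2r.
by case: ifP => // _; rewrite -!EFinB; congr EFin; rewrite opprB addrA subrK.
Qed.

Lemma ge0_integral_translation (a : R) (h : R -> \bar R) :
  measurable_fun [set: R] h -> (forall x, 0 <= h x) ->
  \int[mu]_x h (x + a)%R = \int[mu]_x h x.
Proof.
move=> mh h0.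
have ma : measurable_fun setT
    ((fun x => x + a)%R : measurableTypeR R -> measurableTypeR R).
  by exact: measurable_funD.
rewrite -(@ge0_integral_pushforward _ _ _ _ R _ ma mu setT h)//.
by apply: eq_measure_integral => //= A mA _; exact: lebesgue_measure_translation.
Qed.

Lemma ge0_integral_reflection (h : R -> \bar R) :
  measurable_fun [set: R] h -> (forall x, 0 <= h x) ->
  \int[mu]_x h (- x)%R = \int[mu]_x h x.
Proof.
move=> mh h0.
have ma : measurable_fun setT (-%R : measurableTypeR R -> measurableTypeR R) by [].
rewrite -(@ge0_integral_pushforward _ _ _ _ R _ ma mu setT h)//.
by apply: eq_measure_integral => //= A mA _; exact: lebesgue_measureN.
Qed.

(** Both [f] and the Radon-Nikodym derivative of [nu] have the same integral over every measurable
    set, so they agree almost everywhere, and the change of variables formula for the derivative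
    carries over to [f]. *)
Lemma ge0_integral_density
    (nu : {finite_measure set (measurableTypeR R) -> \bar R}) (f : R -> R) (g : R -> \bar R) :
  measurable_fun [set: R] f -> (forall x, 0 <= f x)%R ->
  (forall A, measurable A -> nu A = \int[mu]_(x in A) (f x)%:E) ->
  measurable_fun [set: R] g -> (forall x, 0 <= g x) ->
  \int[nu]_x g x = \int[mu]_x (g x * (f x)%:E).
Proof.
move=> mf f0 nuE mg g0.
have mEf : measurable_fun setT (EFin \o f) by exact/measurable_EFinP.
have numu : nu `<< mu.
  apply/null_content_dominatesP => A mA muA0; rewrite nuE//.
  by apply: null_set_integral => //; exact: measurable_funTS.
rewrite -(@Radon_Nikodym_SigmaFinite.change_of_variables _
  (measurableTypeR R) R nu mu numu)//.
have intf : mu.-integrable setT (EFin \o f).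
  apply/integrableP; split => //.
  under eq_integral do rewrite /= ger0_norm//.
  by rewrite -nuE// -ge0_fin_numE// fin_num_measure.
have ae : ae_eq mu setT (Radon_Nikodym_SigmaFinite.f nu mu) (EFin \o f).
  apply: integral_ae_eq => //.
  - exact: Radon_Nikodym_SigmaFinite.f_integrable.
  - by move=> A _ mA; rewrite -nuE// -Radon_Nikodym_SigmaFinite.f_integral.
have mRN : measurable_fun setT (Radon_Nikodym_SigmaFinite.f nu mu).
  exact: measurable_int (Radon_Nikodym_SigmaFinite.f_integrable numu).
apply: ae_eq_integral => //.
- exact: emeasurable_funM.
- exact: emeasurable_funM.
- exact: ae_eqe_mul2l.
Qed.

End lebesgue_real_line.

(** * Iterated integrals over the coordinates of a tuple *)

Section coordinate_integrals.
Local Open Scope ereal_scope.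
Context {R : realType} {m : nat}.
Local Notation mu := (@lebesgue_measure R).
Local Notation V := (m.-tuple R).
Implicit Types (z : V) (i j : 'I_m) (g : V -> \bar R) (s : seq 'I_m).

Definition upd z i (t : R) : V := [tuple if k == i then t else tnth z k | k < m].

Lemma tnth_upd z i t k : tnth (upd z i t) k = if k == i then t else tnth z k.
Proof. by rewrite tnth_mktuple. Qed.

Lemma upd_upd z i t u : upd (upd z i t) i u = upd z i u.
Proof. by apply: eq_from_tnth => k; rewrite !tnth_upd; case: eqP. Qed.

Lemma upd_comm z i j t u : i != j ->
  upd (upd z i t) j u = upd (upd z j u) i t.
Proof.
move=> ij; apply: eq_from_tnth => k; rewrite !tnth_upd.
by case: (eqVneq k j) => // ->; rewrite eq_sym (negbTE ij).
Qed.

Lemma measurable_upd d (T : measurableType d) (h : T -> V) i (u : T -> R) :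
  measurable_fun setT h -> measurable_fun setT u ->
  measurable_fun setT (fun x => upd (h x) i (u x)).
Proof.
move=> mh mu'; apply/measurable_fun_tnthP => k.
have [->|ki] := eqVneq k i.
  rewrite (_ : _ \o _ = u)//; apply/funext => x.
  by rewrite /= tnth_upd eqxx.
rewrite (_ : _ \o _ = (fun x => tnth (h x) k)); last first.
  by apply/funext => x; rewrite /= tnth_upd (negbTE ki).
by move/measurable_fun_tnthP : mh => /(_ k).
Qed.

(** The result is still a function of the whole tuple, constant in coordinate [i]. Integrals over
    different coordinates therefore compose and can be compared without changing the dimension. *)
Definition coord_int i g : V -> \bar R := fun z => \int[mu]_t g (upd z i t).

(** By [foldr], the last coordinate of the list is integrated first. *)
Definition coord_ints s g : V -> \bar R := foldr coord_int g s.

Definition indep_coord i g := forall z t, g (upd z i t) = g z.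

Lemma coord_int_ge0 i g : (forall z, 0 <= g z) -> forall z, 0 <= coord_int i g z.
Proof. by move=> g0 z; exact: integral_ge0. Qed.

Lemma measurable_comp_upd i g z : measurable_fun setT g ->
  measurable_fun setT (fun t => g (upd z i t)).
Proof.
by move=> mg; apply: (measurableT_comp mg); exact: measurable_upd.
Qed.

Lemma measurable_coord_int i g : measurable_fun setT g ->
  (forall z, 0 <= g z) -> measurable_fun setT (coord_int i g).
Proof.
move=> mg g0.
apply: (@measurable_fun_fubini_tonelli_F _ _ V _ R mu
  (fun x : V * R => g (upd x.1 i x.2))) => //.
by apply: (measurableT_comp mg); exact: measurable_upd.
Qed.

Lemma coord_ints_ge0 s g : (forall z, 0 <= g z) ->
  forall z, 0 <= coord_ints s g z.
Proof. by move=> g0; elim: s => //= i s; exact: coord_int_ge0. Qed.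

Lemma measurable_coord_ints s g : measurable_fun setT g ->
  (forall z, 0 <= g z) -> measurable_fun setT (coord_ints s g).
Proof.
move=> mg g0; elim: s => //= i s IH.
by apply: measurable_coord_int => //; exact: coord_ints_ge0.
Qed.

Lemma coord_intC i j g : measurable_fun setT g -> (forall z, 0 <= g z) ->
  coord_int i (coord_int j g) = coord_int j (coord_int i g).
Proof.
have [->//|ij] := eqVneq i j; move=> mg g0; apply/funext => z.
rewrite /coord_int.
pose f (x : measurableTypeR R * measurableTypeR R) :=
  g (upd (upd z i x.1) j x.2).
have mf : measurable_fun setT f.
  apply: (measurableT_comp mg); apply: measurable_upd => //.
  exact: measurable_upd.
rewrite [LHS](@fubini_tonelli _ _ _ _ R mu mu f mf (fun=> g0 _)).
by apply: eq_integral => t _; apply: eq_integral => u _; rewrite /f/= upd_comm.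
Qed.

Lemma coord_ints_rem i s g : measurable_fun setT g -> (forall z, 0 <= g z) ->
  i \in s -> coord_ints s g = coord_int i (coord_ints (rem i s) g).
Proof.
move=> mg g0; elim: s => //= j s IH; rewrite inE.
have [->//|ij /= si] := eqVneq i j.
rewrite (coord_intC i j); [|exact: measurable_coord_ints|exact: coord_ints_ge0].
by congr coord_int; exact: IH.
Qed.

(** Tonelli for arbitrary orders: [coord_intC] swaps neighbours, so each head of [s] can be brought
    to the outermost place in [s']. *)
Lemma perm_coord_ints s s' g : measurable_fun setT g -> (forall z, 0 <= g z) ->
  perm_eq s s' -> coord_ints s g = coord_ints s' g.
Proof.
move=> mg g0; elim: s s' => [s'|i s IH s' ss'].
  by rewrite perm_sym => /perm_nilP ->.
have is' : i \in s' by rewrite -(perm_mem ss') mem_head.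
rewrite (coord_ints_rem _ _ is')//= (IH (rem i s'))//.
by rewrite -(perm_cons i) (perm_trans ss')// perm_to_rem.
Qed.

Lemma coord_intMl i (c g : V -> \bar R) : measurable_fun setT g ->
  (forall z, 0 <= g z) -> (forall z, 0 <= c z) -> indep_coord i c ->
  coord_int i (fun z => c z * g z) = fun z => c z * coord_int i g z.
Proof.
move=> mg g0 c0 ci; apply/funext => z; rewrite /coord_int.
under eq_integral do rewrite ci.
by rewrite ge0_integralZl//; exact: measurable_comp_upd.
Qed.

Lemma coord_intsMl s (c g : V -> \bar R) : measurable_fun setT g ->
  (forall z, 0 <= g z) -> (forall z, 0 <= c z) ->
  {in s, forall i, indep_coord i c} ->
  coord_ints s (fun z => c z * g z) = fun z => c z * coord_ints s g z.
Proof.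
move=> mg g0 c0; elim: s => //= i s IH cs.
rewrite IH => [|j js]; last by apply: cs; rewrite inE js orbT.
rewrite coord_intMl//; last by apply: cs; rewrite mem_head.
- exact: measurable_coord_ints.
- exact: coord_ints_ge0.
Qed.

Lemma indep_coord_int i j g : j = i \/ indep_coord j g ->
  indep_coord j (coord_int i g).
Proof.
move=> ji z t; rewrite /coord_int; apply: eq_integral => u _.
have [->|nji] := eqVneq j i; first by rewrite upd_upd.
case: ji => [ji|gj]; first by rewrite ji eqxx in nji.
by rewrite upd_comm.
Qed.

Lemma indep_coord_ints s j g : j \in s \/ indep_coord j g ->
  indep_coord j (coord_ints s g).
Proof.
elim: s => [[]//|i s IH]; rewrite inE => js; apply: indep_coord_int.
case: js => [/orP[/eqP|js]|gj]; [by left| |]; right; apply: IH; [by left|by right].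
Qed.

(** The coordinates in [s] are changed from those of [z] to those of [z'] one at a time, and no
    change affects [g]. *)
Lemma indep_coord_agree s g z z' : {in s, forall i, indep_coord i g} ->
  (forall i, i \notin s -> tnth z i = tnth z' i) -> g z = g z'.
Proof.
elim: s z => [z _ zz'|i s IH z gs zz'].
  by congr g; apply: eq_from_tnth => i; exact: zz'.
rewrite -(gs i (mem_head i s) z (tnth z' i)); apply: IH => j js.
  by apply: gs; rewrite inE js orbT.
rewrite tnth_upd; case: eqP => [->//|/eqP ji]; apply: zz'.
by rewrite inE negb_or ji.
Qed.

End coordinate_integrals.

(** * Resampling one of several independent variables *)

Section tuple_boxes.
Context {R : realType} {m : nat}.

(** A pi-system generating the product sigma-algebra, on which mutual independence can be applied
    directly. *)
Definition boxes : set (set (m.-tuple R)) :=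
  [set A | exists2 B : 'I_m -> set R, (forall k, measurable (B k)) &
    A = [set x | forall k, B k (tnth x k)]].

Lemma measurable_box (B : 'I_m -> set R) : (forall k, measurable (B k)) ->
  measurable [set x : m.-tuple R | forall k, B k (tnth x k)].
Proof.
move=> mB.
rewrite (_ : mkset _ = \bigcap_(k in [set: 'I_m]) ((@tnth _ R)^~ k @^-1` B k)).
  apply: fin_bigcap_measurable => // k _.
  by rewrite -[X in measurable X]setTI; exact: measurable_tnth.
by apply/seteqP; split=> [x Bx k _|x Bx k]; [exact: Bx|exact: (Bx k I)].
Qed.

Lemma measurable_boxes : @measurable _ (m.-tuple R) = <<s boxes >>.
Proof.
apply/seteqP; split; last first.
  apply: smallest_sub; first exact: sigma_algebra_measurable.
  by move=> _ [B mB ->]; exact: measurable_box.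
apply: smallest_sub; first exact: smallest_sigma_algebra.
rewrite -bigcup_seq/= => A [i _ [Y mY <-]]; apply: sub_sigma_algebra.
(* A generating cylinder is a box with a single constrained side. *)
exists (fun k => if k == i then Y else setT).
  by move=> k; case: ifP.
apply/seteqP; split=> [x [_ Yx] k|x /(_ i)]; last by rewrite eqxx.
by case: eqP => // ->.
Qed.

Lemma setI_closed_boxes : setI_closed boxes.
Proof.
move=> _ _ [B mB ->] [B' mB' ->]; exists (fun k => B k `&` B' k).
  by move=> k; exact: measurableI.
apply/seteqP; split=> [x [Bx B'x] k|x BB'x]; first by split.
by split=> k; have [] := BB'x k.
Qed.

End tuple_boxes.

Section resampling.
Local Open Scope ereal_scope.
Context (R : realType) (n : nat) (d : measure_display) (T : measurableType d)
  (P : probability T R) (X : 'I_n -> {RV P >-> R}).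
Hypothesis X_indep : mutually_independent X.

Definition steps (t : T) : n.-tuple R := [tuple X k t | k < n].

Lemma measurable_steps : measurable_fun setT steps.
Proof.
apply/measurable_fun_tnthP => k.
rewrite (_ : _ \o _ = X k); first exact: measurable_funP.
by apply/funext => t /=; rewrite tnth_mktuple.
Qed.

(* A box in R^n pulls back along [(t, u) |-> upd (steps t) i u] to a rectangle,
   so independence identifies the two laws on boxes. *)
Lemma integral_resample (i : 'I_n) (nu : probability (measurableTypeR R) R)
    (g : n.-tuple R -> \bar R) :
  (forall A : set R, measurable A -> nu A = P (X i @^-1` A)) ->
  measurable_fun setT g -> (forall x, 0 <= g x) ->
  \int[P]_t g (steps t) = \int[P]_t \int[nu]_u g (upd (steps t) i u).
Proof.
move=> nuE mg g0.
pose phi (x : T * measurableTypeR R) := upd (steps x.1) i x.2.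
have mphi : measurable_fun setT phi.
  apply: measurable_upd; last exact: measurable_snd.
  exact: (measurableT_comp measurable_steps).
rewrite -[RHS](@fubini_tonelli1 _ _ _ _ R P nu (g \o phi)
  (measurableT_comp mg mphi) (fun=> g0 _)).
rewrite -(@ge0_integral_pushforward _ _ _ _ R _ measurable_steps P setT g)//.
rewrite -(@ge0_integral_pushforward _ _ _ _ R _ mphi (P \x nu) setT g)//.
apply: eq_measure_integral => [|ms A mA _]; first exact: measurable_steps.
move: A mA.
(* The whole space is itself a box, so a constant sequence serves as the exhaustion by sets of
   finite mass. *)
apply: (measure_unique boxes (fun=> setT) measurable_boxes setI_closed_boxes).
- move=> _; exists (fun=> setT) => //.
  by apply/seteqP; split.
- by rewrite bigcup_const.
- move=> _ [B mB ->]; 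
  change (P (steps @^-1` [set x | forall k, B k (tnth x k)]) =
    (P \x nu) (phi @^-1` [set x | forall k, B k (tnth x k)])).
  have -> : steps @^-1` [set x | forall k, B k (tnth x k)] =
      \bigcap_(k in [set` [set: 'I_n]%SET]) (X k @^-1` B k).
    apply/seteqP; split=> t /= Bt k; last first.
      by rewrite tnth_mktuple; apply: Bt; rewrite /= inE.
    by move=> _; have := Bt k; rewrite tnth_mktuple.
  rewrite X_indep//.
  have -> : phi @^-1` [set x | forall k, B k (tnth x k)] =
      (\bigcap_(k in [set` [set~ i]%SET]) (X k @^-1` B k)) `*` B i.
    apply/seteqP; split=> [[t u] Bt|[t u] [/= Bt Bu] k].
      split=> /=; last by have := Bt i; rewrite tnth_upd eqxx.
      move=> k /=; rewrite !inE => ki; have := Bt k.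
      by rewrite tnth_upd (negbTE ki) tnth_mktuple.
    rewrite tnth_upd; case: eqP => [->//|/eqP ki].
    by rewrite tnth_mktuple; apply: Bt; rewrite /= !inE.
  have mA0 : measurable (\bigcap_(k in [set` [set~ i]%SET]) (X k @^-1` B k)).
    apply: fin_bigcap_measurable => // k _.
    by rewrite -[X in measurable X]setTI; exact: measurable_funP.
  rewrite (product_measure1E P nu mA0 (mB i)).
  transitivity
    (P (\bigcap_(k in [set` [set~ i]%SET]) (X k @^-1` B k)) * nu (B i)) => //.
  rewrite X_indep// nuE// [RHS]muleC (bigD1 i) ?inE//=; congr (_ * _).
  by apply: eq_bigl => k; rewrite !inE.
- move=> _; change (P (steps @^-1` setT) < +oo).
  by rewrite preimage_setT probability_setT ltry.
Qed.

End resampling.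

(** * The law of the walk *)

Section random_walk.
Local Open Scope ereal_scope.
Context {R : realType} {n : nat}.
Local Notation mu := (@lebesgue_measure R).

(** Endpoints of a step as ordinals whose bounds hold by construction; [levE] reconciles them with
    the [inord] form in [lev]. *)
Definition step_start (k : 'I_n) : 'I_n.+1 := widen_ord (leqnSn n) k.
Definition step_end (k : 'I_n) : 'I_n.+1 := lift ord0 k.

Lemma step_endE k : step_end k = k.+1 :> nat.
Proof. by rewrite /= /bump leq0n add1n. Qed.

Definition walk (x : n.-tuple R) : n.+1.-tuple R :=
  [tuple walk_position (tnth x) i | i < n.+1].

Lemma walk_step_end x k :
  tnth (walk x) (step_end k) = (tnth (walk x) (step_start k) + tnth x k)%R.
Proof.
rewrite !tnth_mktuple /walk_position (bigD1 k); last by rewrite step_endE.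
rewrite [LHS]addrC; congr (_ + _)%R; apply: eq_bigl => j.
by rewrite step_endE ltnS ltn_neqAle andbC.
Qed.

Lemma walk_upd_le x (k : 'I_n) u (i : 'I_n.+1) : (i <= k)%N ->
  tnth (walk (upd x k u)) i = tnth (walk x) i.
Proof.
move=> ik; rewrite !tnth_mktuple; apply: eq_bigr => j ji.
by rewrite tnth_upd; case: eqP => // jk; move: ji; rewrite jk ltnNge ik.
Qed.

(** Replacing step [k] shifts every later position as well; among the positions up to k+1 only the
    end of the step moves, hence the bound on [i]. *)
Lemma walk_upd x (k : 'I_n) u (i : 'I_n.+1) : (i <= k.+1)%N ->
  tnth (walk (upd x k u)) i =
  tnth (upd (walk x) (step_end k) (u + tnth (walk x) (step_start k))) i.
Proof.
rewrite leq_eqVlt ltnS => /orP[/eqP ik|ik].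
  have -> : i = step_end k by apply: val_inj; exact: etrans ik (esym (step_endE k)).
  by rewrite walk_step_end walk_upd_le// !tnth_upd !eqxx addrC.
rewrite walk_upd_le// tnth_upd; case: eqP => // ik'.
by move: ik; rewrite ik' step_endE ltnn.
Qed.

Lemma measurable_walk : measurable_fun setT walk.
Proof.
apply/measurable_fun_tnthP => i.
rewrite (_ : _ \o _ = fun x : n.-tuple R =>
    (\sum_(k <- enum 'I_n) (if (k < i)%N then tnth x k else 0))%R).
  apply: measurable_sum => k.
  by case: (k < i)%N => //; exact: measurable_tnth.
by apply/funext => x /=; rewrite tnth_mktuple /walk_position big_mkcond big_enum.
Qed.

Context (d : measure_display) (T : measurableType d) (P : probability T R)
  (X : 'I_n -> {RV P >-> R}).
Hypothesis X_indep : mutually_independent X.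
Variable f : R -> R.
Hypothesis mf : measurable_fun [set: R] f.
Hypothesis f_ge0 : (forall x, 0 <= f x)%R.
Hypothesis X_density : forall k, has_density (X k) f.

Let W t := walk (steps X t).

Let jump k (z : n.+1.-tuple R) : R :=
  f (tnth z (step_end k) - tnth z (step_start k))%R.

Let measurable_jump k : measurable_fun setT (jump k).
Proof.
apply: (measurableT_comp mf); apply: measurable_funB; exact: measurable_tnth.
Qed.

(* [lebesgue_measure] lives on [measurableTypeR R], whose sigma-algebra is
   convertible to that of [R] but carries another display. *)
Lemma law_on_measurableTypeR (Y : {RV P >-> R}) :
  exists nu : probability (measurableTypeR R) R,
    forall A : set R, measurable A -> nu A = P (Y @^-1` A).
Proof.
have mY : measurable_fun setT (Y : T -> measurableTypeR R).
  exact: (measurable_funP Y).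
pose Y' : {mfun T >-> measurableTypeR R} :=
  HB.pack (Y : T -> measurableTypeR R) (isMeasurableFun.Build _ _ _ _ _ mY).
by exists (distribution P Y').
Qed.

(** Step [k] is resampled independently of the others. Since [G] ignores positions after k+1, this
    amounts to moving the end of the step, and a translation by its start turns the integral over
    the step into one over a position. *)
Lemma integral_walk_step (k : 'I_n) (G : n.+1.-tuple R -> \bar R) :
  measurable_fun setT G -> (forall z, 0 <= G z) ->
  (forall i : 'I_n.+1, (k.+1 < i)%N -> indep_coord i G) ->
  \int[P]_t G (W t) =
  \int[P]_t coord_int (step_end k) (fun z => G z * (jump k z)%:E) (W t).
Proof.
move=> mG G0 indG.
have [nu nuE] := law_on_measurableTypeR (X k).
rewrite (integral_resample X_indep nuE (measurableT_comp mG measurable_walk)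
  (fun=> G0 _)).
apply: eq_integral => t _; rewrite /coord_int.
set a := tnth (W t) (step_start k).
have mGu : measurable_fun setT (fun u : R => G (upd (W t) (step_end k) u)).
  exact: measurable_comp_upd.
(* The positions after k+1 now keep their old values, which is harmless because [G] does not see
   them. *)
transitivity (\int[nu]_u G (upd (W t) (step_end k) (u + a)%R)).
  apply: eq_integral => u _ /=.
  pose later := [seq i : 'I_n.+1 <- enum 'I_n.+1 | (k.+1 < i)%N].
  have indep_later : {in later, forall i, indep_coord i G}.
    by move=> i; rewrite mem_filter => /andP[/indG].
  apply: (indep_coord_agree indep_later) => i.
  by rewrite mem_filter mem_enum andbT -leqNgt; exact: walk_upd.
have mGua : measurable_fun setT
    (fun u : R => G (upd (W t) (step_end k) (u + a)%R)).
  by apply: (measurableT_comp mGu); exact: measurable_funD.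
rewrite (ge0_integral_density mf f_ge0 _ mGua)//; last first.
  move=> A mA; transitivity (P (X k @^-1` A)); [exact: nuE|exact: X_density].
pose h (v : R) := G (upd (W t) (step_end k) v) * (f (v - a)%R)%:E.
have hE v : h v = G (upd (W t) (step_end k) v) *
    (jump k (upd (W t) (step_end k) v))%:E.
  rewrite /jump !tnth_upd eqxx ifF//; apply/negbTE/eqP => /(congr1 val)/=.
  by rewrite /bump add1n => /eqP; rewrite ltn_eqF.
under [RHS]eq_integral do rewrite -hE.
rewrite -(@ge0_integral_translation _ a h).
- by apply: eq_integral => u _; rewrite /h addrK.
- apply: emeasurable_funM => //; apply/measurable_EFinP.
  by apply: (measurableT_comp mf); exact: measurable_funB.
- by move=> v; rewrite mule_ge0// lee_fin.
Qed.

(** Steps are converted into position integrals from the last one backwards. The outer integral over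
    [P] stays, but its integrand then depends only on the starting position. *)
Lemma integral_walk (H : n.+1.-tuple R -> \bar R) :
  measurable_fun setT H -> (forall z, 0 <= H z) ->
  \int[P]_t H (W t) =
  \int[P]_t coord_ints [seq i : 'I_n.+1 <- enum 'I_n.+1 | (0 < i)%N]
    (fun z => H z * (\prod_(k < n) jump k z)%:E) (W t).
Proof.
move=> mH H0.
pose s m := [seq i : 'I_n.+1 <- enum 'I_n.+1 | (m < i)%N].
pose F m z := H z * (\prod_(k < n | (m <= k)%N) jump k z)%:E.
have mF m : measurable_fun setT (F m).
  apply: emeasurable_funM => //; apply/measurable_EFinP.
  rewrite (_ : (fun _ => _) = fun z =>
    (\prod_(k <- enum 'I_n) (if (m <= k)%N then jump k z else 1))%R).
    by apply: measurable_prod => k _; case: (m <= k)%N.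
  by apply/funext => z; rewrite big_mkcond big_enum.
have F0 m z : 0 <= F m z.
  by rewrite mule_ge0// lee_fin prodr_ge0// => k _; exact: f_ge0.
(* The invariant after [j] conversions: positions beyond n-j are integrated, and the densities of
   the last [j] steps appear as factors. *)
suff step j : (j <= n)%N ->
    \int[P]_t H (W t) = \int[P]_t coord_ints (s (n - j)%N) (F (n - j)%N) (W t).
  by rewrite (step n)// subnn.
elim: j => [_|j IH jn].
  apply: eq_integral => t _; rewrite subn0 /s.
  rewrite (_ : [seq _ <- _ | _] = [::])/=.
    rewrite /F big_pred0 ?mule1// => k.
    by rewrite leqNgt ltn_ord.
  apply/eqP; rewrite -size_eq0 size_filter -leqn0 leqNgt -has_count.
  by apply/hasPn => i _; rewrite -leqNgt -ltnS.
rewrite IH 1?ltnW//.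
set m := (n - j.+1)%N.
have mE : (n - j = m.+1)%N by rewrite /m -subSn.
have mn : (m < n)%N by rewrite -mE leq_subr.
pose k := Ordinal mn; rewrite mE.
rewrite (@integral_walk_step k)//; last 3 first.
- exact: measurable_coord_ints.
- exact: coord_ints_ge0.
- move=> i ki; apply: indep_coord_ints; left.
  by rewrite mem_filter ki mem_enum.
apply: eq_integral => t _.
rewrite (@perm_coord_ints _ _ (s m) (step_end k :: s m.+1))//=; last first.
  apply: uniq_perm; first by rewrite filter_uniq// enum_uniq.
    by rewrite /= mem_filter step_endE ltnn filter_uniq// enum_uniq.
  move=> i; rewrite in_cons /s !mem_filter -!enumT !mem_enum !andbT.
  rewrite [LHS]leq_eqVlt; congr (_ || _).
  by rewrite -val_eqE eq_sym/= /bump add1n.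
congr (coord_int _ _ _); apply/funext => z.
(* Step [k] involves only positions k and k+1, so its density can be moved inside the integrals over
   later positions. *)
have jump_indep : {in s m.+1, forall i, indep_coord i (fun z => (jump k z)%:E)}.
  move=> i; rewrite mem_filter => /andP[ki _] z' u.
  rewrite /jump !tnth_upd !ifF//; apply/negbTE; rewrite -val_eqE/= ?/bump ltn_eqF//.
  by rewrite (leq_trans _ ki).
have := coord_intsMl (mF m.+1) (F0 m.+1) _ jump_indep.
move=> /(_ (fun=> f_ge0 _)) /(congr1 (@^~ z)) /=.
rewrite [in RHS]muleC => <-.
congr (coord_ints _ _ _); apply/funext => z'.
rewrite /F muleCA; congr (_ * _).
rewrite [in RHS](bigD1 k)//= EFinM; congr (_ * _%:E).
by apply: eq_bigl => l; rewrite ltn_neqAle andbC eq_sym.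
Qed.

End random_walk.

(** * Ordinal patterns and levels *)

Section ordinal_patterns.
Context {R : realType}.

Lemma card_ord_le m (x : 'I_m) : #|[pred k : 'I_m | (k <= x)%N]| = x.+1.
Proof.
rewrite -[RHS]card_ord -[LHS]sum1_card -[RHS]sum1_card.
by rewrite (big_ord_widen m (fun=> 1%N) (ltn_ord x)).
Qed.

Lemma card_perm_le m (pi : 'S_m) (i : 'I_m) :
  #|[pred j : 'I_m | (pi j <= pi i)%N]| = (pi i).+1.
Proof.
rewrite -card_ord_le -[LHS]sum1_card -[RHS]sum1_card.
by rewrite [RHS](reindex_inj (@perm_inj _ pi)).
Qed.

(** If z b <= z a, then everything below z b is below z a, so the ranks compare the same way.
    Conversely, an order-preserving [z] has the same rank counts as [pi]. *)
Lemma has_ordinal_patternP m (z : 'I_m -> R) (pi : 'S_m) :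
  has_ordinal_pattern z pi <-> forall a b, (pi a < pi b)%N -> z a < z b.
Proof.
split=> [[_ rank] a b|mono].
  apply: contraTT; rewrite -leNgt -leqNgt => zba.
  rewrite -ltnS !rank subset_leq_card//; apply/fintype.subsetP => j.
  by rewrite !inE => /le_trans; apply.
have inj_z : injective z.
  move=> a b zab; apply: (@perm_inj _ pi); apply: val_inj.
  by case: (ltngtP (pi a) (pi b)) => // /mono; rewrite zab ltxx.
split=> // i; rewrite -card_perm_le; apply: eq_card => j; rewrite !inE.
case: (ltngtP (pi j) (pi i)) => [/mono/ltW->//|/mono|/val_inj/perm_inj ->].
  by rewrite ltNge => /negbTE ->.
by rewrite lexx.
Qed.

End ordinal_patterns.

(** * Gaps between sorted positions, and the levels that steps cross *)

Section sorted_positions.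
Context {R : realType} {n : nat} (pi : 'S_n.+1).
Implicit Types (z : n.+1.-tuple R) (i j : nat).

(** Ranks are natural numbers so that sums and products of gaps run over intervals of [nat]. Beyond
    [n], [inord] falls back to rank 0, which is why bounds j <= n recur below. *)
Definition time_of_rank j : 'I_n.+1 := (pi^-1)%g (inord j).

Definition ranked z j : R := tnth z (time_of_rank j).

Definition gap z j : R := ranked z j.+1 - ranked z j.

Definition crosses (k : 'I_n) j : bool :=
  (pi (step_start k) <= j < pi (step_end k))%N
  || (pi (step_end k) <= j < pi (step_start k))%N.

Lemma levE (j : 'I_n) : lev pi j = #|[pred k | crosses k j]|.
Proof.
apply: eq_card => k; rewrite !inE /crosses.
have -> : inord k = step_start k.
  by apply: val_inj; rewrite /= inordK// ltnW// ltnS.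
by have -> : inord k.+1 = step_end k;
  first by apply: val_inj; rewrite [RHS]step_endE /= inordK// ltnS.
Qed.

Lemma time_of_rankK (i : 'I_n.+1) : time_of_rank (pi i) = i.
Proof. by rewrite /time_of_rank inord_val permK. Qed.

Lemma rank_time_of_rank j : (j <= n)%N -> pi (time_of_rank j) = j :> nat.
Proof. by move=> jn; rewrite /time_of_rank permKV inordK. Qed.

Lemma time_of_rank_eq i j : (i <= n)%N -> (j <= n)%N ->
  (time_of_rank i == time_of_rank j) = (i == j).
Proof.
move=> ni nj; apply/eqP/eqP => [|->//].
by move=> /(congr1 (fun x => nat_of_ord (pi x))); rewrite !rank_time_of_rank.
Qed.

(** If no step crossed level [j], all positions would lie on the same side of it as the starting
    position; but ranks 0 and [n] lie on opposite sides. *)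
Lemma lev_gt0 (j : 'I_n) : (0 < lev pi j)%N.
Proof.
rewrite levE lt0n; apply/negP => /eqP/card0_eq no_cross.
have side i : (i <= n)%N ->
    (pi (inord i) <= j)%N = (pi (inord 0) <= j)%N.
  elim: i => // i IH ni; rewrite -(IH (ltnW ni)).
  have := no_cross (Ordinal ni); rewrite !inE /crosses.
  have -> : step_start (Ordinal ni) = inord i.
    by apply: val_inj; rewrite /= inordK// ltnW.
  have -> : step_end (Ordinal ni) = inord i.+1.
    by apply: val_inj; rewrite [LHS]step_endE /= inordK.
  rewrite !ltnNge.
  by case: (pi (inord i) <= j)%N; case: (pi (inord i.+1) <= j)%N.
have rank_side r : (r <= n)%N -> (r <= j)%N = (pi (inord 0) <= j)%N.
  move=> nr; rewrite -(side (time_of_rank r)); last by rewrite -ltnS.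
  by rewrite inord_val rank_time_of_rank.
by have := rank_side n (leqnn n); rewrite -(rank_side 0%N)// leqNgt ltn_ord.
Qed.

Definition pattern_sorted z : bool := [forall j : 'I_n, 0 < gap z j].

Lemma pattern_sortedP z :
  reflect (has_ordinal_pattern (tnth z) pi) (pattern_sorted z).
Proof.
apply/(iffP forallP) => [sorted|/has_ordinal_patternP mono j]; last first.
  rewrite subr_gt0; apply: mono; have jn := ltn_ord j.
  by rewrite !rank_time_of_rank// ltnW.
apply/has_ordinal_patternP => a b.
have mono i j : (j <= n)%N -> (i < j)%N -> ranked z i < ranked z j.
  elim: j => // j IH jn; rewrite ltnS leq_eqVlt.
  have jj1 : ranked z j < ranked z j.+1.
    by have := sorted (Ordinal jn); rewrite subr_gt0.
  by case/orP => [/eqP ->//|ij]; apply: lt_trans jj1; apply: IH => //; exact: ltnW.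
move=> /mono; rewrite -ltnS ltn_ord /ranked !time_of_rankK; exact.
Qed.

(** A difference of two telescoping sums, each starting at rank 0. *)
Lemma sum_gap_between z a c : (c <= a)%N -> (a <= n)%N ->
  \sum_(0 <= j < n) (c <= j < a)%:R * gap z j = ranked z a - ranked z c.
Proof.
move=> ca an.
have prefix e : (e <= n)%N ->
    \sum_(0 <= j < n) (j < e)%:R * gap z j = ranked z e - ranked z 0%N.
  move=> en; rewrite (@big_cat_nat _ _ _ e)//= -telescope_sumr//.
  rewrite [X in _ + X]big_nat [X in _ + X]big1 ?addr0; last first.
    by move=> j /andP[ej _]; rewrite ltnNge ej mul0r.
  by rewrite big_nat [RHS]big_nat; apply: eq_bigr => j /andP[_ ->]; rewrite mul1r.
have -> : ranked z a - ranked z c =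
    (ranked z a - ranked z 0%N) - (ranked z c - ranked z 0%N).
  by rewrite opprB addrA subrK.
rewrite -!prefix ?(leq_trans ca)// -sumrB; apply: eq_bigr => j _.
rewrite -mulrBl; congr (_ * _).
case: (leqP c j) => [cj|jc]; rewrite ?subr0//=.
by rewrite (leq_trans jc)// subrr.
Qed.

Lemma abs_step z (k : 'I_n) : pattern_sorted z ->
  `|tnth z (step_end k) - tnth z (step_start k)| =
  \sum_(0 <= j < n) (crosses k j)%:R * gap z j.
Proof.
move=> /forallP sorted.
have gap_ge0 j : (j < n)%N -> 0 <= gap z j.
  by move=> jn; have /ltW := sorted (Ordinal jn).
have between (a c : 'I_n.+1) : (pi c <= pi a)%N -> `|tnth z a - tnth z c| =
    \sum_(0 <= j < n) (pi c <= j < pi a)%N%:R * gap z j.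
  move=> ca; rewrite sum_gap_between//; last by rewrite -ltnS.
  rewrite /ranked !time_of_rankK ger0_norm//.
  rewrite -[X in 0 <= tnth z X - _](time_of_rankK a).
  rewrite -[X in 0 <= _ - tnth z X](time_of_rankK c).
  rewrite -[X in 0 <= X]/(ranked z (pi a) - ranked z (pi c)).
  rewrite -sum_gap_between//; last by rewrite -ltnS.
  rewrite big_nat sumr_ge0// => j /andP[_ jn].
  by rewrite mulr_ge0// gap_ge0.
case: (leqP (pi (step_start k)) (pi (step_end k))) => [le|/ltnW le].
  rewrite between//; apply: eq_bigr => j _; congr ((nat_of_bool _)%:R * _).
  rewrite /crosses; case: (_ <= _ < _)%N => //=.
  (* For an upward step the downward crossing condition is contradictory. *)
  by apply/esym/negbTE/negP => /andP[/(leq_trans le)]; rewrite leqNgt => /negbTE->.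
rewrite distrC between//; apply: eq_bigr => j _; congr ((nat_of_bool _)%:R * _).
rewrite /crosses orbC; case: (_ <= _ < _)%N => //=.
by apply/esym/negbTE/negP => /andP[/(leq_trans le)]; rewrite leqNgt => /negbTE->.
Qed.

(** Double counting of the pairs of a step and a level that it crosses. *)
Lemma sum_abs_steps z : pattern_sorted z ->
  \sum_(k < n) `|tnth z (step_end k) - tnth z (step_start k)| =
  \sum_(j < n) (lev pi j)%:R * gap z j.
Proof.
move=> sorted; under eq_bigr do rewrite abs_step// big_mkord.
rewrite exchange_big/=; apply: eq_bigr => j _.
rewrite -mulr_suml; congr (_ * _).
rewrite levE -sum1_card natr_sum [RHS]big_mkcond/=.
by apply: eq_bigr => k _; rewrite inE; case: crosses.
Qed.

End sorted_positions.

(** * Integrating out the extreme positions *)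

Section laplace_density.
Context {R : realType}.
Local Notation mu := (@lebesgue_measure R).
Variable b : R.
Hypothesis b_gt0 : 0 < b.

Lemma laplace_pdf_ge0 x : 0 <= laplace_pdf b x.
Proof. by rewrite mulr_ge0 ?expR_ge0// divr_ge0// mulr_ge0// ltW. Qed.

Lemma measurable_laplace_pdf : measurable_fun [set: R] (laplace_pdf b).
Proof.
apply: measurable_funM => //; apply: measurableT_comp => //.
by apply: measurable_funM => //; apply: measurableT_comp.
Qed.

(** There are as many gaps as steps, so each gap can take one constant 1/(2b). The value 0 at
    nonpositive gaps encodes the indicator of the pattern. *)
Definition gap_density (l : nat) (y : R) : R :=
  if 0 < y then 1 / (2 * b) * expR (- (l%:R * y) / b) else 0.

Lemma gap_density_ge0 l y : 0 <= gap_density l y.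
Proof.
rewrite /gap_density; case: ifP => // _.
by rewrite mulr_ge0 ?expR_ge0// divr_ge0// mulr_ge0// ltW.
Qed.

Lemma measurable_gap_density l : measurable_fun [set: R] (gap_density l).
Proof.
apply: measurable_fun_ifT => //; first exact: measurable_fun_ltr.
apply: measurable_funM => //; apply: measurableT_comp => //.
by apply: measurable_funM => //; apply: measurableT_comp.
Qed.

Lemma integral_gap_density l : (0 < l)%N ->
  (\int[mu]_y (gap_density l y)%:E = (1 / (2 * l%:R))%:E)%E.
Proof.
move=> l_gt0; have l0 : 0 < l%:R :> R by rewrite ltr0n.
pose rate := l%:R / b; have rate_gt0 : 0 < rate by rewrite divr_gt0.
have c_ge0 : 0 <= 1 / (2 * l%:R) :> R by rewrite divr_ge0// mulr_ge0// ltW.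
have mexp (D : set (measurableTypeR R)) : measurable_fun D
    (fun y : measurableTypeR R => (rate * expR (- rate * y))%:E).
  apply/measurable_EFinP/measurable_funTS; apply: measurable_funM => //.
  by apply: measurableT_comp => //; exact: measurable_funM.
(* The integrand is 1/(2l) times the exponential density of rate l/b, since 1/(2b) = 1/(2l) *
   (l/b). *)
transitivity (\int[mu]_(y in `]0%R, +oo[)
    ((1 / (2 * l%:R))%:E * (rate * expR (- rate * y))%:E))%E.
  rewrite [RHS]integral_mkcond; apply: eq_integral => y _.
  rewrite patchE /gap_density mem_setE in_itv/= andbT; case: ifP => // y0.
  rewrite -EFinM; congr EFin; rewrite mulrA; congr (_ * expR _).
    rewrite /rate; field.
    by rewrite !gt_eqF.
  by rewrite /rate !mulNr mulrAC.
rewrite ge0_integralZl//; last first.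
  by move=> y _; rewrite lee_fin mulr_ge0 ?expR_ge0// ltW.
(* The endpoint 0 is added because [exponential_pdf] is supported on the closed half-line. *)
rewrite integral_itv_obnd_cbnd; last exact: mexp.
rewrite -[RHS]mule1 -(integral_exponential_pdf rate_gt0); congr (_ * _)%E.
rewrite [LHS]integral_mkcond; apply: eq_integral => y _.
by rewrite /exponential_pdf !patchE; case: ifP.
Qed.

End laplace_density.

(** * Integration of a product of gap factors, one extreme rank at a time *)

Section peeling.
Local Open Scope ereal_scope.
Context {R : realType} {n : nat} (pi : 'S_n.+1).
Local Notation mu := (@lebesgue_measure R).
Local Notation w := (time_of_rank pi).
Variables (phi : nat -> R -> R) (c : nat -> R).
Hypothesis mphi : forall j, measurable_fun [set: R] (phi j).
Hypothesis phi_ge0 : forall j y, (0 <= phi j y)%R.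
Hypothesis int_phi :
  forall j, (j < n)%N -> \int[mu]_y (phi j y)%:E = (c j)%:E.

(** The product over the gaps between ranks [a] and [m]: what is left, up to constants, once the
    ranks below [a] and above [m] are integrated out. *)
Let G a m (z : n.+1.-tuple R) : R :=
  (\prod_(a <= j < m) phi j (gap pi z j))%R.

Let EG a m z := (G a m z)%:E.

Let measurable_EG a m : measurable_fun setT (EG a m).
Proof.
apply/measurable_EFinP; apply: measurable_prod => j _.
apply: (measurableT_comp (mphi j)).
by apply: measurable_funB; exact: measurable_tnth.
Qed.

Let EG_ge0 a m z : 0 <= EG a m z.
Proof. by rewrite lee_fin prodr_ge0. Qed.

Let c_ge0 j : (j < n)%N -> (0 <= c j)%R.
Proof.
move=> jn; rewrite -lee_fin -int_phi// integral_ge0// => y _.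
by rewrite lee_fin.
Qed.

Let G_upd a m i z t : (m <= n)%N -> (i < a)%N || (m < i <= n)%N ->
  G a m (upd z (w i) t) = G a m z.
Proof.
move=> mn ai; rewrite /G big_nat [RHS]big_nat; apply: eq_bigr => j /andP[aj jm].
have jn := leq_trans jm mn.
rewrite /gap /ranked !tnth_upd !time_of_rank_eq ?(ltnW jn)//; last 2 first.
- by case/orP: ai => [ia|/andP[]//]; rewrite (leq_trans (ltnW ia))// (leq_trans aj)// ltnW.
- by case/orP: ai => [ia|/andP[]//]; rewrite (leq_trans (ltnW ia))// (leq_trans aj)// ltnW.
case/orP: ai => [ia|/andP[mi _]].
  by rewrite !gtn_eqF// ?ltnS ?(leq_trans ia)// ltnW// (leq_trans ia).
by rewrite !ltn_eqF// ?(leq_ltn_trans jm)// (ltn_trans jm).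
Qed.

(** The highest remaining position occurs in the last gap only; translation by its lower neighbour
    yields the integral of [phi m]. *)
Let peel_top m : (m < n)%N ->
  coord_int (w m.+1) (EG 0 m.+1) = fun z => (c m)%:E * EG 0 m z.
Proof.
move=> mn; apply/funext => z; rewrite /coord_int.
have mphi' : measurable_fun [set: R] (fun y => (phi m y)%:E) by exact/measurable_EFinP.
under eq_integral => t _.
  rewrite /EG /G big_nat_recr//= EFinM -/(G 0 m _) G_upd ?(ltnW mn)//; last first.
    by rewrite ltnSn mn orbT.
  rewrite /gap /ranked !tnth_upd eqxx time_of_rank_eq// ?(ltnW mn)// ltn_eqF//.
  over.
have mphir : measurable_fun [set: R]
    (fun t => (phi m (t - tnth z (w m))%R)%:E).
  by apply: (measurableT_comp mphi'); exact: measurable_funB.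
rewrite ge0_integralZl//; last 2 first.
- by move=> t _; rewrite lee_fin.
- exact: EG_ge0.
rewrite muleC; congr (_ * _); rewrite -int_phi//.
by apply: (ge0_integral_translation (- tnth z (w m))%R mphi') => y; rewrite lee_fin.
Qed.

(** The lowest remaining position enters its only gap with a minus sign, so a reflection is needed
    besides the translation. *)
Let peel_bottom a m : (a < m)%N -> (m <= n)%N ->
  coord_int (w a) (EG a m) = fun z => (c a)%:E * EG a.+1 m z.
Proof.
move=> am mn; have an := leq_trans am mn.
apply/funext => z; rewrite /coord_int.
have mphi' : measurable_fun [set: R] (fun y => (phi a y)%:E) by exact/measurable_EFinP.
under eq_integral => t _.
  rewrite /EG /G big_ltn// EFinM -/(G a.+1 m _) G_upd ?ltnSn//.
  rewrite /gap /ranked !tnth_upd eqxx time_of_rank_eq// ?(ltnW an)// gtn_eqF//.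
  over.
pose r := ranked pi z a.+1.
have mphir : measurable_fun [set: R] (fun y => (phi a (y + r)%R)%:E).
  by apply: (measurableT_comp mphi'); exact: measurable_funD.
have mphirB : measurable_fun [set: R]
    (fun t => (phi a (tnth z (w a.+1) - t)%R)%:E).
  by apply: (measurableT_comp mphi'); exact: measurable_funB.
rewrite ge0_integralZr//; last 2 first.
- by move=> t _; rewrite lee_fin.
- exact: EG_ge0.
have phi0 y : 0 <= (phi a y)%:E by rewrite lee_fin.
congr (_ * _); rewrite -int_phi// -(ge0_integral_translation r mphi' phi0).
rewrite -(ge0_integral_reflection mphir (fun=> phi0 _)).
by apply: eq_integral => t _; rewrite addrC.
Qed.

Let coord_intsZ s m a (e : R) : (0 <= e)%R ->
  coord_ints s (fun z => e%:E * EG a m z) =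
  fun z => e%:E * coord_ints s (EG a m) z.
Proof.
by move=> e0; rewrite (@coord_intsMl _ _ s (fun=> e%:E) _ (measurable_EG a m)).
Qed.

Let prod_c_ge0 p q : (q <= n)%N -> (0 <= \prod_(p <= j < q) c j)%R.
Proof.
move=> qn; rewrite big_nat prodr_ge0// => j /andP[_ jq].
by apply: c_ge0; exact: leq_trans qn.
Qed.

Let peel_tops p q : (p + q <= n)%N ->
  coord_ints [seq w j | j <- iota p.+1 q] (EG 0 (p + q)) =
  fun z => (\prod_(p <= j < p + q) c j)%:E * EG 0 p z.
Proof.
elim: q => [_|q IH pqn].
  by apply/funext => z; rewrite addn0 big_geq//= mul1e.
rewrite addnS in pqn *.
rewrite -[q.+1]addn1 iotaD map_cat /coord_ints foldr_cat/= addSn peel_top//.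
rewrite -/(coord_ints _ _) coord_intsZ ?c_ge0// IH 1?ltnW//.
apply/funext => z; rewrite muleA big_nat_recr ?leq_addr//= EFinM.
by rewrite [in RHS](muleC _ (c _)%:E).
Qed.

(** The list is reversed so that rank 0, being last, is integrated first. *)
Let peel_bottoms p q : (q <= p)%N -> (p <= n)%N ->
  coord_ints [seq w j | j <- rev (iota 0 q)] (EG 0 p) =
  fun z => (\prod_(0 <= j < q) c j)%:E * EG q p z.
Proof.
move=> + pn; elim: q => [_|q IH qp].
  by apply/funext => z; rewrite big_geq//= mul1e.
rewrite -[q.+1]addn1 iotaD rev_cat/= IH 1?ltnW//.
rewrite (coord_intMl (c := fun=> (\prod_(0 <= j < q) c j)%:E))//; last first.
  by move=> z; rewrite lee_fin prod_c_ge0// (leq_trans _ pn)// ltnW.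
rewrite peel_bottom//; apply/funext => z.
by rewrite muleA addn1 big_nat_recr//= EFinM.
Qed.

(* Integrate out the extreme positions first: from the top rank down to the
   rank of position 0, then from the bottom rank up to it. *)
Lemma coord_ints_gaps z :
  coord_ints [seq i : 'I_n.+1 <- enum 'I_n.+1 | (0 < i)%N]
    (fun z => (\prod_(0 <= j < n) phi j (gap pi z j))%:E) z =
  (\prod_(0 <= j < n) c j)%:E.
Proof.
pose p := nat_of_ord (pi ord0); have pn : (p <= n)%N by rewrite /p -ltnS.
pose ranks := rev (iota 0 p) ++ iota p.+1 (n - p).
have mem_ranks j : (j \in ranks) = (j <= n)%N && (j != p).
  rewrite mem_cat mem_rev !mem_iota/= add0n addSn subnKC// ltnS.
  case: (ltngtP j p) => [jp|jp|->] /=; rewrite ?andbT ?andbF//.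
  by rewrite (leq_trans (ltnW jp) pn).
have uniq_ranks : uniq ranks.
  rewrite cat_uniq rev_uniq !iota_uniq/= andbT; apply/hasPn => j.
  by rewrite mem_iota mem_rev mem_iota/= add0n => /andP[pj _]; rewrite -leqNgt ltnW.
rewrite -[X in coord_ints _ X]/(EG 0 n).
(* Times after 0 are exactly the times of ranks other than [p], so Tonelli allows integration in the
   order of [ranks]. *)
rewrite (@perm_coord_ints _ _ _ [seq w j | j <- ranks])//; last first.
  apply: uniq_perm; first by rewrite filter_uniq// enum_uniq.
    rewrite map_inj_in_uniq// => i j; rewrite !mem_ranks.
    move=> /andP[ni _] /andP[nj _] /eqP.
    by rewrite time_of_rank_eq// => /eqP.
  move=> i; rewrite mem_filter mem_enum andbT.
  rewrite -{2}(time_of_rankK pi i).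
  apply/idP/mapP => [i0|[j]].
    exists (nat_of_ord (pi i)) => //; rewrite mem_ranks -ltnS ltn_ord/=.
    by apply: contraTneq i0 => /val_inj/perm_inj ->.
  rewrite mem_ranks => /andP[jn jp]; rewrite time_of_rankK => ->.
  rewrite lt0n; apply: contraNneq jp => w0; rewrite /p.
  have -> : ord0 = w j by apply: val_inj; rewrite /= w0.
  by rewrite rank_time_of_rank.
rewrite /ranks map_cat /coord_ints foldr_cat -/(coord_ints _ _) -/(coord_ints _ _).
have := @peel_tops p (n - p); rewrite subnKC// => -> //.
rewrite coord_intsZ ?prod_c_ge0// peel_bottoms//.
(* Only the starting position is left, and with it no gap. *)
have -> : EG p p z = 1 by rewrite /EG /G big_geq.
rewrite mule1 -EFinM mulrC.
by rewrite -big_cat_nat.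
Qed.

End peeling.

(** * The pattern event and the factorised density *)

Section indicator.
Context {R : realType} {n : nat} (pi : 'S_n.+1) (b : R).

Lemma measurable_pattern_sorted :
  measurable_fun setT (pattern_sorted (R := R) pi).
Proof.
apply: (measurable_fun_bool true); rewrite setTI.
rewrite (_ : _ @^-1` _ = \bigcap_(j in [set: 'I_n])
    ((fun z : n.+1.-tuple R => 0 < gap pi z j) @^-1` [set true])).
  apply: fin_bigcap_measurable => // j _.
  rewrite -[X in measurable X]setTI; apply: measurable_fun_ltr => //.
  by apply: measurable_funB; exact: measurable_tnth.
apply/seteqP; split=> [z /forallP sorted j _|z sorted]; first exact: sorted.
by apply/forallP => j; exact: (sorted j I).
Qed.

(** Off the event some gap is nonpositive and both sides vanish. On it the constants match one to
    one, and the exponents agree by [sum_abs_steps]. *)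
Lemma sorted_laplace_prod (z : n.+1.-tuple R) :
  (pattern_sorted pi z)%:R *
    \prod_(k < n) laplace_pdf b (tnth z (step_end k) - tnth z (step_start k)) =
  \prod_(j < n) gap_density b (lev pi j) (gap pi z j).
Proof.
case: (boolP (pattern_sorted pi z)) => [sorted|]; last first.
  rewrite negb_forall => /existsP[j /negbTE jgap].
  by rewrite mul0r (bigD1 j)//= /gap_density jgap mul0r.
rewrite mul1r /laplace_pdf.
under [RHS]eq_bigr => j _.
  rewrite /gap_density; have /forallP -> := sorted; over.
rewrite !big_split/=; congr (_ * _).
rewrite -!expR_sum; congr expR.
by rewrite -!mulr_suml !sumrN (sum_abs_steps sorted).
Qed.

End indicator.

Theorem theorem3p3 (R : realType) (n : nat) (n_ge1 : (1 <= n)%N)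
    (pi : 'S_n.+1) (b : R) (b_gt0 : 0 < b)
    (d : measure_display) (T : measurableType d) (P : probability T R)
    (X : 'I_n -> {RV P >-> R})
    (X_indep : mutually_independent X)
    (X_density : forall k : 'I_n, has_density (X k) (laplace_pdf b)) :
  P [set t | has_ordinal_pattern (walk_position (fun k => X k t)) pi] =
  (1 / (2 ^+ n * \prod_(j < n) (lev pi j)%:R))%:E.
Proof.
pose H (z : n.+1.-tuple R) : \bar R := (pattern_sorted pi z)%:R%:E.
have mS := measurable_pattern_sorted (R := R) pi.
have mH : measurable_fun setT H.
  apply/measurable_EFinP.
  rewrite (_ : (fun _ => _) = (fun z => if pattern_sorted pi z then 1 else 0)).
    exact: measurable_fun_ifT.
  by apply/funext => z; case: pattern_sorted.
have H0 z : (0 <= H z)%E by rewrite lee_fin.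
pose W t := walk (steps X t).
have mW : measurable_fun setT W.
  exact: measurableT_comp (measurable_walk) (measurable_steps X).
have WE t : tnth (W t) = walk_position (fun k => X k t).
  apply/funext => i; rewrite tnth_mktuple; apply: eq_bigr => k _.
  by rewrite tnth_mktuple.
pose A := [set t | pattern_sorted pi (W t)].
have mA : measurable A.
  by rewrite -[A]setTI; apply: (measurableT_comp mS mW) => //;
    exact: (measurable_set1 true).
have -> : [set t | has_ordinal_pattern (walk_position (fun k => X k t)) pi] = A.
  by apply/seteqP; split=> t; rewrite /= -WE => /pattern_sortedP.
transitivity (\int[P]_t H (W t))%E.
  rewrite -(setIT A) -integral_indic//; apply: eq_integral => t _.
  by rewrite indicE mem_setE.
rewrite (integral_walk X_indep (measurable_laplace_pdf b)
  (laplace_pdf_ge0 b_gt0) X_density mH H0).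
(* An extension of [lev pi] from ordinals to all natural numbers, as the products over gaps
   require. *)
pose l (j : nat) := #|[pred k | crosses pi k j]|.
pose c (j : nat) : R := 1 / (2 * (l j)%:R).
have int_gap j : (j < n)%N ->
    (\int[lebesgue_measure]_y (gap_density b (l j) y)%:E = (c j)%:E)%E.
  move=> jn; apply: integral_gap_density => //.
  by have := lev_gt0 pi (Ordinal jn); rewrite levE.
have := @coord_ints_gaps R n pi (fun j => gap_density b (l j)) c
  (fun j => measurable_gap_density b (l j))
  (fun j => gap_density_ge0 b_gt0 (l j)) int_gap.
have -> : (fun z => (\prod_(0 <= j < n) gap_density b (l j) (gap pi z j))%:E) =
    (fun z => H z * (\prod_(k < n)
       laplace_pdf b (tnth z (step_end k) - tnth z (step_start k)))%:E)%E.
  apply/funext => z; rewrite -EFinM sorted_laplace_prod big_mkord; congr EFin.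
  by apply: eq_bigr => j _; rewrite levE.
(* The integrand is now constant and [P] has total mass 1. *)
move=> coordE; under eq_integral do rewrite coordE.
rewrite integral_cst//= probability_setT mule1 big_mkord; congr EFin.
have cE (j : 'I_n) : c j = 1 / (2 * (lev pi j)%:R) by rewrite levE.
rewrite (eq_bigr _ (fun j _ => cE j)).
by rewrite prodf_div big_split/= !prodr_const card_ord expr1n.
Qed.
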